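(* The family of perfect crystals $\{B^{5,l}\}_{l\ge1}$ for $D_5^{(1)}$ forms a coherent family, and the crystal $B^{5,\infty}$ is its limit with the vector $b^\infty=\mathbf 0$ (i.e. $(b^\infty)_{ij}=0$ for all $1\le i\le5$, $i\le j\le i+4$).
   Context: **Cartan datum.** $\mathfrak g=D_5^{(1)}$, $I=\{0,\dots,5\}$, Cartan matrix $a_{ii}=2$, $a_{ij}=-1$ for $\{i,j\}\in\{\{0,2\},\{1,2\},\{2,3\},\{3,4\},\{3,5\}\}$, $0$ otherwise; simple coroots $\check\alpha_k$, fundamental weights $\Lambda_k$, $\langle\check\alpha_k,\Lambda_j\rangle=\delta_{kj}$; $P_{cl}=\bigoplus_{k=0}^5\mathbb Z\Lambda_k$; canonical central element $\mathbf c=\check\alpha_0+\check\alpha_1+2\check\alpha_2+2\check\alpha_3+\check\alpha_4+\check\alpha_5$. **The sets.** $b=(b_{ij})_{1\le i\le5,\ i\le j\le i+4}$. $B^{5,l}$ ($l\ge1$) is the set of such $b$ with $b_{ij}\in\mathbb Z_{\ge0}$, $\sum_{j=i}^{i+4}b_{ij}=l$ ($1\le i\le5$), $\sum_{j=i}^{5-t}b_{ij}=\sum_{j=i+t}^{4+t}b_{i+t,j}$ ($1\le i,t\le4$, $i+t\le5$), and $\sum_{j=i}^{t}b_{ij}\ge\sum_{j=i+1}^{t+1}b_{i+1,j}$ ($1\le i\le t\le4$). $B^{5,\infty}$ is the set of such $b$ with $b_{ij}\in\mathbb Z$, $\sum_{j=i}^{i+4}b_{ij}=0$ ($1\le i\le5$),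 and $\sum_{j=i}^{5-t}b_{ij}=\sum_{j=i+t}^{4+t}b_{i+t,j}$ ($1\le i,t\le4$, $i+t\le5$). **Conditions.** With $(x)_+=\max(x,0)$ and $S=b_{14}-b_{22}-b_{23}+b_{33}+b_{34}$: - $(E_1)$: $b_{22}>b_{13}+b_{14}+b_{44}$, $b_{22}+b_{23}>b_{14}+b_{33}+b_{34}$, $b_{22}>b_{14}+b_{33}+(b_{13}-b_{24})_+$. - $(E_2)$: $b_{33}+b_{34}>b_{13}+b_{23}+b_{44}$, $b_{14}+b_{33}+b_{34}\ge b_{22}+b_{23}$, $b_{34}>b_{23}+(b_{13}-b_{24})_+$. - $(E_3)$: $b_{33}>b_{13}+b_{44}$, $b_{24}>b_{13}$, $b_{14}+b_{33}\ge b_{22}+(S)_+$. - $(E_4)$: $b_{33}>b_{24}+b_{44}$, $b_{13}\ge b_{24}$, $b_{13}+b_{14}+b_{33}\ge b_{22}+b_{24}+(S)_+$. - $(E_5)$: $b_{13}+b_{44}\ge b_{33}+(b_{13}-b_{24})_+$, $b_{13}+b_{14}+b_{44}\ge b_{22}+(S)_+$. $(F_j)$ is obtained from $(E_j)$ by replacing $>$ with $\ge$ and $\ge$ with $>$. **Operators** (on $\mathcal B=B^{5,l}$ or $B^{5,\infty}$). Below, ''$+$: ...; $-$: ...'' lists the index pairs of entries increased, resp. decreased, by $1$; other entries are unchanged. Moves: - $m_{0,1}$: $+$: 15,26,37,48,59; $-$: 11,22,35,46,57. - $m_{0,2}$: $+$: 14,25,37,48,59; $-$: 11,22,34,45,57.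 - $m_{0,3}$: $+$: 14,23,25,37,46,48,59; $-$: 11,22,24,33,45,47,56. - $m_{0,4}$: $+$: 13,25,36,48,59; $-$: 11,22,33,45,56. - $m_{0,5}$: $+$: 13,24,35,48,59; $-$: 11,22,33,44,55. - $m_{1}$: $+$: 11,58; $-$: 12,59. - $m_{2,1}$: $+$: 12,47; $-$: 13,48. $m_{2,2}$: $+$: 22,57; $-$: 23,58. - $m_{3,1}$: $+$: 13,36; $-$: 14,37. $m_{3,2}$: $+$: 23,46; $-$: 24,47. $m_{3,3}$: $+$: 33,56; $-$: 34,57. - $m_{4,1}$: $+$: 14,25; $-$: 15,26. $m_{4,2}$: $+$: 34,45; $-$: 35,46. - $m_{5,1}$: $+$: 24,35; $-$: 25,36. $m_{5,2}$: $+$: 44,55; $-$: 45,56. $\tilde e_k(b)$ applies the following move: $k=0$: $m_{0,j}$ if $(E_j)$; $k=1$: $m_1$; $k=2$: $m_{2,1}$ if $b_{12}\ge b_{23}$, $m_{2,2}$ if $b_{12}<b_{23}$; $k=3$: $m_{3,1}$ if $b_{13}\ge b_{24}$ and $b_{13}+b_{23}\ge b_{24}+b_{34}$, $m_{3,2}$ if $b_{13}<b_{24}$ and $b_{23}\ge b_{34}$, $m_{3,3}$ if $b_{23}<b_{34}$ and $b_{13}+b_{23}<b_{24}+b_{34}$; $k=4$: $m_{4,1}$ if $b_{14}+b_{33}+b_{34}\ge b_{22}+b_{23}$, $m_{4,2}$ otherwise; $k=5$: $m_{5,1}$ if $b_{24}+b_{44}\ge b_{33}$, $m_{5,2}$ otherwise.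 $\tilde f_k(b)$ applies the inverse (signs reversed) of the following move: $k=0$: $m_{0,j}$ if $(F_j)$; $k=1$: $m_1$; $k=2$: $m_{2,1}$ if $b_{12}>b_{23}$, $m_{2,2}$ if $b_{12}\le b_{23}$; $k=3$: $m_{3,1}$ if $b_{13}>b_{24}$ and $b_{13}+b_{23}>b_{24}+b_{34}$, $m_{3,2}$ if $b_{13}\le b_{24}$ and $b_{23}>b_{34}$, $m_{3,3}$ if $b_{23}\le b_{34}$ and $b_{13}+b_{23}\le b_{24}+b_{34}$; $k=4$: $m_{4,1}$ if $b_{14}+b_{33}+b_{34}>b_{22}+b_{23}$, $m_{4,2}$ otherwise; $k=5$: $m_{5,1}$ if $b_{24}+b_{44}>b_{33}$, $m_{5,2}$ otherwise. For $b\in B^{5,l}$, if the result is not in $B^{5,l}$ it is declared to be $0$. **Functions.** Let $\ell=l$ on $B^{5,l}$ and $\ell=0$ on $B^{5,\infty}$. - $\varepsilon_0=\ell+\max\{-b_{45}-b_{46}-b_{47}-b_{48},\ -b_{13}-b_{34}-b_{35}-b_{36}-b_{37},\ -b_{24}-b_{34}-b_{35}-b_{36}-b_{37},\ -b_{13}-b_{14}-b_{23}-b_{24}-b_{25}-b_{26},\ -b_{13}-b_{23}-b_{35}-b_{36}-b_{37}\}$ - $\varepsilon_1=b_{12}$; $\varepsilon_2=\max\{b_{13},-b_{12}+b_{13}+b_{23}\}$ - $\varepsilon_3=\max\{b_{14},-b_{13}+b_{14}+b_{24},-b_{13}+b_{14}-b_{23}+b_{24}+b_{34}\}$ - $\varepsilon_4=\ell+\max\{-b_{11}-b_{12}-b_{13}-b_{14},\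 -b_{11}-b_{12}-b_{13}-2b_{14}+b_{22}+b_{23}-b_{33}-b_{34}\}$ - $\varepsilon_5=\max\{b_{11}+b_{12}+b_{13}-b_{22}-b_{23}-b_{24},\ b_{11}+b_{12}+b_{13}-b_{22}-b_{23}-2b_{24}+b_{33}-b_{44}\}$ - $\varphi_0=\ell+\max\{-b_{11}-b_{12}-b_{13}-b_{14},\ -b_{11}-b_{12}-b_{22}+b_{44},\ -b_{11}-b_{12}-b_{13}-b_{22}+b_{33},\ -b_{11}-b_{12}-b_{22}-b_{24}+b_{33},\ -b_{11}-b_{12}-b_{13}-b_{22}-b_{23}+b_{33}+b_{34}\}$ - $\varphi_1=b_{11}-b_{22}$; $\varphi_2=\max\{b_{22}-b_{33},\ b_{12}+b_{22}-b_{23}-b_{33}\}$ - $\varphi_3=\max\{b_{33}-b_{44},\ b_{23}+b_{33}-b_{34}-b_{44},\ b_{13}+b_{23}-b_{24}+b_{33}-b_{34}-b_{44}\}$ - $\varphi_4=\ell+\max\{-b_{33}-b_{35}-b_{36}-b_{37},\ b_{14}-b_{22}-b_{23}+b_{34}-b_{35}-b_{36}-b_{37}\}$ - $\varphi_5=\max\{b_{44},\ b_{24}-b_{33}+2b_{44}\}$ $\varepsilon(b)=\sum_k\varepsilon_k(b)\Lambda_k$, $\varphi(b)=\sum_k\varphi_k(b)\Lambda_k$, $\mathrm{wt}(b)=\varphi(b)-\varepsilon(b)\in P_{cl}$. **Known fact.** $B^{5,l}$ is a perfect crystal of level $l$ (Kang–Kashiwara–Misra–Miwa–Nakashima–Nakayashiki),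 with set of minimal elements $(B^{5,l})_{\min}=\{b\in B^{5,l}:\langle\mathbf c,\varepsilon(b)\rangle=l\}=\{b\in B^{5,l}:\varepsilon_0+\varepsilon_1+2\varepsilon_2+2\varepsilon_3+\varepsilon_4+\varepsilon_5=l\}$. **Crystals $T_\lambda$.** For $\lambda\in P_{cl}$, $T_\lambda=\{t_\lambda\}$ with $\mathrm{wt}(t_\lambda)=\lambda$, $\varepsilon_k(t_\lambda)=\varphi_k(t_\lambda)=-\infty$, $\tilde e_kt_\lambda=\tilde f_kt_\lambda=0$. The crystal $T_\lambda\otimes B^{5,l}\otimes T_\mu$ has $\tilde e_k(t_\lambda\otimes b\otimes t_\mu)=t_\lambda\otimes\tilde e_kb\otimes t_\mu$, similarly for $\tilde f_k$, $\varepsilon_k(t_\lambda\otimes b\otimes t_\mu)=\varepsilon_k(b)-\langle\check\alpha_k,\lambda\rangle$, $\varphi_k(t_\lambda\otimes b\otimes t_\mu)=\varphi_k(b)+\langle\check\alpha_k,\mu\rangle$, $\mathrm{wt}(t_\lambda\otimes b\otimes t_\mu)=\lambda+\mu+\mathrm{wt}(b)$. **Embedding of crystals** $B_1\to B_2$: an injective map $\psi:B_1\sqcup\{0\}\to B_2\sqcup\{0\}$ with $\psi(0)=0$ that preserves $\mathrm{wt},\varepsilon_k,\varphi_k$ and such that whenever $b,b'\in B_1$ and $\tilde f_kb=b'$ (equivalently $\tilde e_kb'=b$), then $\tilde f_k\psi(b)=\psi(b')$ and $\tilde e_k\psi(b')=\psi(b)$. **Coherent family and limit** (Kang–Kashiwara–Misra).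 Let $\{B_l\}_{l\ge1}$ be a family of perfect crystals, $B_l$ of level $l$, and $J=\{(l,b):l\in\mathbb Z_{>0},\ b\in(B_l)_{\min}\}$. A crystal $B_\infty$ with an element $b_\infty$ is a limit of the family if: (1) $\mathrm{wt}(b_\infty)=0$ and $\varepsilon(b_\infty)=\varphi(b_\infty)=0$; (2) for every $(l,b)\in J$ there is an embedding of crystals $f_{(l,b)}:T_{\varepsilon(b)}\otimes B_l\otimes T_{-\varphi(b)}\to B_\infty$ with $f_{(l,b)}(t_{\varepsilon(b)}\otimes b\otimes t_{-\varphi(b)})=b_\infty$; (3) $B_\infty=\bigcup_{(l,b)\in J}\mathrm{Im}\,f_{(l,b)}$. The family is coherent if it has a limit. *)

(* Defs.v *)
From mathcomp Require Import all_boot all_order all_algebra.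
From mathcomp Require Import zify.

Set Implicit Arguments.
Unset Strict Implicit.
Unset Printing Implicit Defensive.

Import Order.TTheory GRing.Theory Num.Theory.
Local Open Scope ring_scope.

Notation idx := 'I_6.

Definition cartan (i j : idx) : int :=
  let adj := [:: (0, 2); (1, 2); (2, 3); (3, 4); (3, 5)]%N in
  if i == j then 2
  else if ((i : nat, j : nat) \in adj) || ((j : nat, i : nat) \in adj) then -1
  else 0.

(* [la : Pcl] stands for \sum_k la k * Lambda_k, so that la k is the pairing
   of the coroot alpha^vee_k with la. *)
Notation Pcl := {ffun idx -> int}.

Definition simple_root (k : idx) : Pcl := [ffun i => cartan i k].

Definition central_pairing (la : Pcl) : int :=
  \sum_(k : idx) nth 0 [:: 1; 1; 2; 2; 1; 1] k * la k.

(* In the codomain of [eps] and [phi], [None] is -oo; in the codomain of [e]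
   and [f], [None] is the extra element 0. *)
Record crystal := Crystal {
  carrier :> Type;
  wt : carrier -> Pcl;
  eps : idx -> carrier -> option int;
  phi : idx -> carrier -> option int;
  e : idx -> carrier -> option carrier;
  f : idx -> carrier -> option carrier }.

Record is_crystal (B : crystal) : Prop := IsCrystal {
  crystal_phi (k : idx) (b : B) :
    phi k b = omap (fun n => n + wt b k) (eps k b);
  crystal_e (k : idx) (b b' : B) : e k b = Some b' ->
    [/\ wt b' = wt b + simple_root k,
        eps k b' = omap (fun n => n - 1) (eps k b)
      & phi k b' = omap (fun n => n + 1) (phi k b)];
  crystal_f (k : idx) (b b' : B) : f k b = Some b' ->
    [/\ wt b' = wt b - simple_root k,
        eps k b' = omap (fun n => n + 1) (eps k b)
      & phi k b' = omap (fun n => n - 1) (phi k b)];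
  crystal_ef (k : idx) (b b' : B) : f k b = Some b' <-> e k b' = Some b;
  crystal_ninfty (k : idx) (b : B) :
    phi k b = None -> e k b = None /\ f k b = None }.

Definition finite_valued (B : crystal) : Prop :=
  forall (k : idx) (b : B), eps k b <> None /\ phi k b <> None.

(* The weights \sum_k eps_k(b) Lambda_k and \sum_k phi_k(b) Lambda_k; they are
   only used in finite-valued crystals. *)
Definition eps_wt (B : crystal) (b : B) : Pcl := [ffun k => odflt 0 (eps k b)].
Definition phi_wt (B : crystal) (b : B) : Pcl := [ffun k => odflt 0 (phi k b)].

Inductive T_carrier (la : Pcl) : Type := t_elt.
Arguments t_elt la : clear implicits.

Definition T (la : Pcl) : crystal :=
  @Crystal (T_carrier la) (fun _ => la) (fun _ _ => None) (fun _ _ => None)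
    (fun _ _ => None) (fun _ _ => None).

(* The crystal T_la (x) B (x) T_mu. *)
Definition TBT (la : Pcl) (B : crystal) (mu : Pcl) : crystal :=
  @Crystal (T la * B * T mu)%type
    (fun x => la + mu + wt x.1.2)
    (fun k x => omap (fun n => n - la k) (eps k x.1.2))
    (fun k x => omap (fun n => n + mu k) (phi k x.1.2))
    (fun k x => omap (fun b => (x.1.1, b, x.2)) (e k x.1.2))
    (fun k x => omap (fun b => (x.1.1, b, x.2)) (f k x.1.2)).

Definition tbt (la : Pcl) (B : crystal) (b : B) (mu : Pcl) : TBT la B mu :=
  (t_elt la, b, t_elt mu).

Record is_embedding (B1 B2 : crystal) (psi : option B1 -> option B2) : Prop :=
  IsEmbedding {
  emb_inj : injective psi;
  emb_zero : psi None = None;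
  emb_wt (b : B1) (c : B2) : psi (Some b) = Some c -> wt c = wt b;
  emb_eps (k : idx) (b : B1) (c : B2) :
    psi (Some b) = Some c -> eps k c = eps k b;
  emb_phi (k : idx) (b : B1) (c : B2) :
    psi (Some b) = Some c -> phi k c = phi k b;
  emb_ops (k : idx) (b b' : B1) : f k b = Some b' ->
    obind (f k) (psi (Some b)) = psi (Some b') /\
    obind (e k) (psi (Some b')) = psi (Some b) }.

(* The index set J of a family whose l-th member has level l. *)
Definition minimal_in (B : nat -> crystal) (l : nat) (b : B l) : Prop :=
  (0 < l)%N /\ central_pairing (eps_wt b) = l%:Z.

(* Of the perfectness of the members of the family, the definition only uses
   that they are crystals with finite eps and phi, and their levels. *)
Record is_limit (B : nat -> crystal) (Binf : crystal) (binf : Binf) : Prop :=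
  IsLimit {
  limit_family (l : nat) : (0 < l)%N -> is_crystal (B l) /\ finite_valued (B l);
  limit_crystal : is_crystal Binf;
  limit_wt : wt binf = 0;
  limit_eps_phi (k : idx) : eps k binf = Some 0 /\ phi k binf = Some 0;
  limit_embeddings :
    exists F : forall (l : nat) (b : B l),
        option (TBT (eps_wt b) (B l) (- phi_wt b)) -> option Binf,
      (forall (l : nat) (b : B l), minimal_in b ->
         is_embedding (F l b) /\
         F l b (Some (tbt (eps_wt b) b (- phi_wt b))) = Some binf) /\
      (forall x : Binf, exists (l : nat) (b : B l),
         minimal_in b /\ exists y, F l b (Some y) = Some x) }.

Definition coherent (B : nat -> crystal) : Prop :=
  exists (Binf : crystal) (binf : Binf), is_limit B binf.

(* A family (b_ij), 1 <= i <= 5 and i <= j <= i + 4, is a 5 x 5 matrix whose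
   row i - 1 is (b_ii, ..., b_i,i+4). *)
Notation tableau := 'M[int]_5.

Definition entry (b : tableau) (i j : nat) : int := b (inord i.-1) (inord (j - i)).

Notation "b @[ i , j ]" := (entry b i%N j%N)
  (at level 2, left associativity, format "b @[ i ,  j ]") : ring_scope.

(* The quantified ranges are listed by [iota 1 n] = [:: 1; ...; n]. *)
Definition row_sums (l : int) (b : tableau) : bool :=
  all (fun i : nat => \sum_(i <= j < i + 5) b@[i, j] == l) (iota 1 5).

Definition balanced (b : tableau) : bool :=
  all (fun i => all (fun t => (i + t <= 5)%N ==>
      (\sum_(i <= j < 6 - t) b@[i, j] ==
       \sum_(i + t <= j < t + 5) b@[i + t, j]))
    (iota 1 4)) (iota 1 4).

Definition interlaced (b : tableau) : bool :=
  all (fun i => all (fun t => (i <= t)%N ==>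
      (\sum_(i.+1 <= j < t.+2) b@[i.+1, j] <= \sum_(i <= j < t.+1) b@[i, j]))
    (iota 1 4)) (iota 1 4).

Definition nonneg (b : tableau) : bool := [forall i, forall c, 0 <= b i c].

Definition in_B5 (l : nat) (b : tableau) : bool :=
  [&& nonneg b, row_sums l%:Z b, balanced b & interlaced b].

Definition in_B5inf (b : tableau) : bool := row_sums 0 b && balanced b.

Definition pos_part (x : int) : int := Num.max x 0.

Definition S_ (b : tableau) : int :=
  b@[1,4] - b@[2,2] - b@[2,3] + b@[3,3] + b@[3,4].

Definition E1 (b : tableau) : bool :=
  [&& b@[2,2] > b@[1,3] + b@[1,4] + b@[4,4],
      b@[2,2] + b@[2,3] > b@[1,4] + b@[3,3] + b@[3,4]
    & b@[2,2] > b@[1,4] + b@[3,3] + pos_part (b@[1,3] - b@[2,4])].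

Definition E2 (b : tableau) : bool :=
  [&& b@[3,3] + b@[3,4] > b@[1,3] + b@[2,3] + b@[4,4],
      b@[1,4] + b@[3,3] + b@[3,4] >= b@[2,2] + b@[2,3]
    & b@[3,4] > b@[2,3] + pos_part (b@[1,3] - b@[2,4])].

Definition E3 (b : tableau) : bool :=
  [&& b@[3,3] > b@[1,3] + b@[4,4],
      b@[2,4] > b@[1,3]
    & b@[1,4] + b@[3,3] >= b@[2,2] + pos_part (S_ b)].

Definition E4 (b : tableau) : bool :=
  [&& b@[3,3] > b@[2,4] + b@[4,4],
      b@[1,3] >= b@[2,4]
    & b@[1,3] + b@[1,4] + b@[3,3] >= b@[2,2] + b@[2,4] + pos_part (S_ b)].

Definition E5 (b : tableau) : bool :=
  (b@[1,3] + b@[4,4] >= b@[3,3] + pos_part (b@[1,3] - b@[2,4])) &&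
  (b@[1,3] + b@[1,4] + b@[4,4] >= b@[2,2] + pos_part (S_ b)).

Definition F1 (b : tableau) : bool :=
  [&& b@[2,2] >= b@[1,3] + b@[1,4] + b@[4,4],
      b@[2,2] + b@[2,3] >= b@[1,4] + b@[3,3] + b@[3,4]
    & b@[2,2] >= b@[1,4] + b@[3,3] + pos_part (b@[1,3] - b@[2,4])].

Definition F2 (b : tableau) : bool :=
  [&& b@[3,3] + b@[3,4] >= b@[1,3] + b@[2,3] + b@[4,4],
      b@[1,4] + b@[3,3] + b@[3,4] > b@[2,2] + b@[2,3]
    & b@[3,4] >= b@[2,3] + pos_part (b@[1,3] - b@[2,4])].

Definition F3 (b : tableau) : bool :=
  [&& b@[3,3] >= b@[1,3] + b@[4,4],
      b@[2,4] >= b@[1,3]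
    & b@[1,4] + b@[3,3] > b@[2,2] + pos_part (S_ b)].

Definition F4 (b : tableau) : bool :=
  [&& b@[3,3] >= b@[2,4] + b@[4,4],
      b@[1,3] > b@[2,4]
    & b@[1,3] + b@[1,4] + b@[3,3] > b@[2,2] + b@[2,4] + pos_part (S_ b)].

Definition F5 (b : tableau) : bool :=
  (b@[1,3] + b@[4,4] > b@[3,3] + pos_part (b@[1,3] - b@[2,4])) &&
  (b@[1,3] + b@[1,4] + b@[4,4] > b@[2,2] + pos_part (S_ b)).

(* A move (p, m) increases by 1 the entries b_ij with (i, j) in p and
   decreases by 1 those with (i, j) in m. *)
Definition move : Type := (seq (nat * nat) * seq (nat * nat))%type.

Definition apply_move (mv : move) (b : tableau) : tableau :=
  \matrix_(i, c) (b i c + ((i.+1, i.+1 + c)%N \in mv.1)%:R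
                        - ((i.+1, i.+1 + c)%N \in mv.2)%:R).

Definition inverse_move (mv : move) : move := (mv.2, mv.1).

Definition m01 : move := ([:: (1,5); (2,6); (3,7); (4,8); (5,9)],
                          [:: (1,1); (2,2); (3,5); (4,6); (5,7)])%N.
Definition m02 : move := ([:: (1,4); (2,5); (3,7); (4,8); (5,9)],
                          [:: (1,1); (2,2); (3,4); (4,5); (5,7)])%N.
Definition m03 : move :=
  ([:: (1,4); (2,3); (2,5); (3,7); (4,6); (4,8); (5,9)],
   [:: (1,1); (2,2); (2,4); (3,3); (4,5); (4,7); (5,6)])%N.
Definition m04 : move := ([:: (1,3); (2,5); (3,6); (4,8); (5,9)],
                          [:: (1,1); (2,2); (3,3); (4,5); (5,6)])%N.
Definition m05 : move := ([:: (1,3); (2,4); (3,5); (4,8); (5,9)],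
                          [:: (1,1); (2,2); (3,3); (4,4); (5,5)])%N.
Definition m1 : move := ([:: (1,1); (5,8)], [:: (1,2); (5,9)])%N.
Definition m21 : move := ([:: (1,2); (4,7)], [:: (1,3); (4,8)])%N.
Definition m22 : move := ([:: (2,2); (5,7)], [:: (2,3); (5,8)])%N.
Definition m31 : move := ([:: (1,3); (3,6)], [:: (1,4); (3,7)])%N.
Definition m32 : move := ([:: (2,3); (4,6)], [:: (2,4); (4,7)])%N.
Definition m33 : move := ([:: (3,3); (5,6)], [:: (3,4); (5,7)])%N.
Definition m41 : move := ([:: (1,4); (2,5)], [:: (1,5); (2,6)])%N.
Definition m42 : move := ([:: (3,4); (4,5)], [:: (3,5); (4,6)])%N.
Definition m51 : move := ([:: (2,4); (3,5)], [:: (2,5); (3,6)])%N.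
Definition m52 : move := ([:: (4,4); (5,5)], [:: (4,5); (5,6)])%N.

(* The conditions of each case list are mutually exclusive and exhaustive (see
   [E_exactly_one], [F_exactly_one], [e_move_total], [f_move_total]). *)
Definition e_move (k : idx) (b : tableau) : option move :=
  match val k with
  | 0 => if E1 b then Some m01 else if E2 b then Some m02
         else if E3 b then Some m03 else if E4 b then Some m04
         else if E5 b then Some m05 else None
  | 1 => Some m1
  | 2 => if b@[1,2] >= b@[2,3] then Some m21 else Some m22
  | 3 => if (b@[1,3] >= b@[2,4]) && (b@[1,3] + b@[2,3] >= b@[2,4] + b@[3,4])
         then Some m31
         else if (b@[1,3] < b@[2,4]) && (b@[2,3] >= b@[3,4]) then Some m32
         else if (b@[2,3] < b@[3,4]) &&
                 (b@[1,3] + b@[2,3] < b@[2,4] + b@[3,4]) then Some m33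
         else None
  | 4 => if b@[1,4] + b@[3,3] + b@[3,4] >= b@[2,2] + b@[2,3] then Some m41
         else Some m42
  | _ => if b@[2,4] + b@[4,4] >= b@[3,3] then Some m51 else Some m52
  end.

(* The move whose inverse is applied by f_k. *)
Definition f_move (k : idx) (b : tableau) : option move :=
  match val k with
  | 0 => if F1 b then Some m01 else if F2 b then Some m02
         else if F3 b then Some m03 else if F4 b then Some m04
         else if F5 b then Some m05 else None
  | 1 => Some m1
  | 2 => if b@[1,2] > b@[2,3] then Some m21 else Some m22
  | 3 => if (b@[1,3] > b@[2,4]) && (b@[1,3] + b@[2,3] > b@[2,4] + b@[3,4])
         then Some m31
         else if (b@[1,3] <= b@[2,4]) && (b@[2,3] > b@[3,4]) then Some m32
         else if (b@[2,3] <= b@[3,4]) &&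
                 (b@[1,3] + b@[2,3] <= b@[2,4] + b@[3,4]) then Some m33
         else None
  | 4 => if b@[1,4] + b@[3,3] + b@[3,4] > b@[2,2] + b@[2,3] then Some m41
         else Some m42
  | _ => if b@[2,4] + b@[4,4] > b@[3,3] then Some m51 else Some m52
  end.

Definition e_tab (k : idx) (b : tableau) : option tableau :=
  omap (fun mv => apply_move mv b) (e_move k b).
Definition f_tab (k : idx) (b : tableau) : option tableau :=
  omap (fun mv => apply_move (inverse_move mv) b) (f_move k b).

Definition max_of (x : int) (s : seq int) : int := foldr Num.max x s.

(* [l] is the level on B^{5,l}, and 0 on B^{5,oo}. *)
Definition eps_tab (l : int) (k : idx) (b : tableau) : int :=
  match val k with
  | 0 => l + max_of (- b@[4,5] - b@[4,6] - b@[4,7] - b@[4,8])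
      [:: - b@[1,3] - b@[3,4] - b@[3,5] - b@[3,6] - b@[3,7];
          - b@[2,4] - b@[3,4] - b@[3,5] - b@[3,6] - b@[3,7];
          - b@[1,3] - b@[1,4] - b@[2,3] - b@[2,4] - b@[2,5] - b@[2,6];
          - b@[1,3] - b@[2,3] - b@[3,5] - b@[3,6] - b@[3,7]]
  | 1 => b@[1,2]
  | 2 => max_of b@[1,3] [:: - b@[1,2] + b@[1,3] + b@[2,3]]
  | 3 => max_of b@[1,4]
      [:: - b@[1,3] + b@[1,4] + b@[2,4];
          - b@[1,3] + b@[1,4] - b@[2,3] + b@[2,4] + b@[3,4]]
  | 4 => l + max_of (- b@[1,1] - b@[1,2] - b@[1,3] - b@[1,4])
      [:: - b@[1,1] - b@[1,2] - b@[1,3] - 2 * b@[1,4] + b@[2,2] + b@[2,3]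
          - b@[3,3] - b@[3,4]]
  | _ => max_of (b@[1,1] + b@[1,2] + b@[1,3] - b@[2,2] - b@[2,3] - b@[2,4])
      [:: b@[1,1] + b@[1,2] + b@[1,3] - b@[2,2] - b@[2,3] - 2 * b@[2,4]
          + b@[3,3] - b@[4,4]]
  end.

Definition phi_tab (l : int) (k : idx) (b : tableau) : int :=
  match val k with
  | 0 => l + max_of (- b@[1,1] - b@[1,2] - b@[1,3] - b@[1,4])
      [:: - b@[1,1] - b@[1,2] - b@[2,2] + b@[4,4];
          - b@[1,1] - b@[1,2] - b@[1,3] - b@[2,2] + b@[3,3];
          - b@[1,1] - b@[1,2] - b@[2,2] - b@[2,4] + b@[3,3];
          - b@[1,1] - b@[1,2] - b@[1,3] - b@[2,2] - b@[2,3] + b@[3,3]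
          + b@[3,4]]
  | 1 => b@[1,1] - b@[2,2]
  | 2 => max_of (b@[2,2] - b@[3,3]) [:: b@[1,2] + b@[2,2] - b@[2,3] - b@[3,3]]
  | 3 => max_of (b@[3,3] - b@[4,4])
      [:: b@[2,3] + b@[3,3] - b@[3,4] - b@[4,4];
          b@[1,3] + b@[2,3] - b@[2,4] + b@[3,3] - b@[3,4] - b@[4,4]]
  | 4 => l + max_of (- b@[3,3] - b@[3,5] - b@[3,6] - b@[3,7])
      [:: b@[1,4] - b@[2,2] - b@[2,3] + b@[3,4] - b@[3,5] - b@[3,6] - b@[3,7]]
  | _ => max_of b@[4,4] [:: b@[2,4] - b@[3,3] + 2 * b@[4,4]]
  end.

Definition wt_tab (l : int) (b : tableau) : Pcl :=
  [ffun k => phi_tab l k b - eps_tab l k b].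

(* A set of tableaux [P] with the structure above; [insub] sends a result
   outside [P] to 0. *)
Definition tab_crystal (P : pred tableau) (l : int) : crystal :=
  @Crystal {b : tableau | P b}
    (fun b => wt_tab l (val b))
    (fun k b => Some (eps_tab l k (val b)))
    (fun k b => Some (phi_tab l k (val b)))
    (fun k b => obind insub (e_tab k (val b)))
    (fun k b => obind insub (f_tab k (val b))).

Definition B5 (l : nat) : crystal := tab_crystal (in_B5 l) l%:Z.

(* On B^{5,oo} the operators never give 0 (see [B5inf_e], [B5inf_f]). *)
Definition B5inf : crystal := tab_crystal in_B5inf 0.

Lemma in_B5inf0 : in_B5inf 0.
Proof.
have s0 (i m n : nat) : \sum_(m <= j < n) (0 : tableau)@[i, j] = 0.
  by apply: big1 => j _; rewrite /entry mxE.
apply/andP; split; first by apply/allP => i _; rewrite s0.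
by apply/allP => i _; apply/allP => t _; rewrite !s0 eqxx implybT.
Qed.

Definition b5inf : B5inf := exist _ 0 in_B5inf0.

Lemma E_exactly_one (b : tableau) :
  count id [:: E1 b; E2 b; E3 b; E4 b; E5 b] = 1%N.
Proof. rewrite /= /E1 /E2 /E3 /E4 /E5 /S_ /pos_part; lia. Qed.

Lemma F_exactly_one (b : tableau) :
  count id [:: F1 b; F2 b; F3 b; F4 b; F5 b] = 1%N.
Proof. rewrite /= /F1 /F2 /F3 /F4 /F5 /S_ /pos_part; lia. Qed.

Lemma e_move_total (k : idx) (b : tableau) : e_move k b <> None.
Proof.
have := E_exactly_one b; rewrite /e_move /=.
case: (E1 b); case: (E2 b); case: (E3 b); case: (E4 b); case: (E5 b) => //= _;
  case: k => -[|[|[|[|[|[]]]]]] // k_lt /=; do ?case: ifP => ? //; lia.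
Qed.

Lemma f_move_total (k : idx) (b : tableau) : f_move k b <> None.
Proof.
have := F_exactly_one b; rewrite /f_move /=.
case: (F1 b); case: (F2 b); case: (F3 b); case: (F4 b); case: (F5 b) => //= _;
  case: k => -[|[|[|[|[|[]]]]]] // k_lt /=; do ?case: ifP => ? //; lia.
Qed.

Definition move_entry (mv : move) (i j : nat) : int :=
  ((i, j) \in mv.1)%:R - ((i, j) \in mv.2)%:R.

Lemma sum_apply_move (mv : move) (b : tableau) (i m n : nat) :
  (0 < i < 6)%N -> (i <= m)%N -> (n <= i + 5)%N ->
  \sum_(m <= j < n) (apply_move mv b)@[i, j] =
    \sum_(m <= j < n) b@[i, j] + \sum_(m <= j < n) move_entry mv i j.
Proof.
move=> /andP[i0 i6] im ni; rewrite -big_split /=.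
rewrite big_nat [RHS]big_nat; apply: eq_bigr => j /andP[mj jn].
rewrite /entry mxE !inordK; try lia.
by rewrite prednK // subnKC ?addrA //; lia.
Qed.

Definition all_moves : seq move :=
  [:: m01; m02; m03; m04; m05; m1; m21; m22; m31; m32; m33; m41; m42; m51; m52].

Definition move_balanced (mv : move) : bool :=
  all (fun i => \sum_(i <= j < i + 5) move_entry mv i j == 0) (iota 1 5) &&
  all (fun i => all (fun t => (i + t <= 5)%N ==>
      (\sum_(i <= j < 6 - t) move_entry mv i j ==
       \sum_(i + t <= j < t + 5) move_entry mv (i + t) j))
    (iota 1 4)) (iota 1 4).

Lemma all_moves_balanced (mv : move) :
  mv \in all_moves ++ map inverse_move all_moves -> move_balanced mv.
Proof.
by move: mv; apply/allP; rewrite /move_balanced unlock; vm_compute.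
Qed.

Lemma in_B5inf_move (mv : move) (b : tableau) :
  mv \in all_moves ++ map inverse_move all_moves ->
  in_B5inf b -> in_B5inf (apply_move mv b).
Proof.
move=> /all_moves_balanced /andP[/allP rmv /allP bmv] /andP[/allP rb /allP bb].
apply/andP; split; apply/allP => i iP; move: (iP); rewrite mem_iota => iP'.
  rewrite sum_apply_move //; try lia.
  by rewrite (eqP (rb i iP)) (eqP (rmv i iP)).
apply/allP => t tP; apply/implyP => it; move: (tP); rewrite mem_iota => tP'.
rewrite !sum_apply_move //; try lia.
have /allP/(_ t tP)/implyP/(_ it)/eqP -> := bb i iP.
by have /allP/(_ t tP)/implyP/(_ it)/eqP -> := bmv i iP.
Qed.

Lemma e_move_in (k : idx) (b : tableau) (mv : move) :
  e_move k b = Some mv -> mv \in all_moves.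
Proof.
rewrite /e_move; case: k => -[|[|[|[|[|[]]]]]] // k_lt /=;
  do ?case: ifP => _ //; by move=> [<-].
Qed.

Lemma f_move_in (k : idx) (b : tableau) (mv : move) :
  f_move k b = Some mv -> mv \in all_moves.
Proof.
rewrite /f_move; case: k => -[|[|[|[|[|[]]]]]] // k_lt /=;
  do ?case: ifP => _ //; by move=> [<-].
Qed.

Lemma B5inf_e (k : idx) (b : B5inf) : e k b <> None.
Proof.
rewrite /= /e_tab; case E: e_move => [mv|] /=; last by case: (e_move_total E).
by rewrite insubT //; apply: in_B5inf_move (valP b); rewrite mem_cat (e_move_in E).
Qed.

Lemma B5inf_f (k : idx) (b : B5inf) : f k b <> None.
Proof.
rewrite /= /f_tab; case E: f_move => [mv|] /=; last by case: (f_move_total E).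
rewrite insubT //; apply: in_B5inf_move (valP b).
by rewrite mem_cat map_f ?orbT // (f_move_in E).
Qed.

(* Main.v *)
Require Import Defs.
From mathcomp Require Import all_boot all_order all_algebra.
From mathcomp Require Import zify.

Set Implicit Arguments.
Unset Strict Implicit.
Unset Printing Implicit Defensive.

Import Order.TTheory GRing.Theory Num.Theory.
Local Open Scope ring_scope.

(* Write a tableau through its ten entries b_ij with i <= 4 and j <= 4; the row
   sum and balance equations make the other fifteen affine functions of these.
   Pairing epsilon with the canonical central element and bounding each maximum
   below by its terms shows that b0 is minimal iff it satisfies five linear
   equations ([tight]), which say that at b0 all the terms inside each
   maximum coincide.  Hence subtracting a minimal b0 shifts every eps_k
   and phi_k by a constant and changes none of the conditions selecting a move,
   so b |-> b - b0 is the required embedding.  Every x in B^{5,oo} is reached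
   because, for K large, the minimal element with eps_k = K for all k has all
   entries and all interlacing margins as large as desired. *)

(** * Linear coordinates on tableaux *)

(** The product of equations serves as a single rewriting rule that eliminates the fifteen dependent
    entries. *)
Lemma lower_entries (l : int) (b : tableau) : row_sums l b && balanced b ->
  (((b@[1,5] = l - b@[1,1] - b@[1,2] - b@[1,3] - b@[1,4]) *
    (b@[2,6] = l - b@[1,1] - b@[1,2] - b@[1,3] - b@[1,4]) *
    (b@[3,7] = l - b@[1,1] - b@[1,2] - b@[1,3]) *
    (b@[4,8] = l - b@[1,1] - b@[1,2]) *
    (b@[5,9] = l - b@[1,1])) *
   ((b@[2,5] = b@[1,1] + b@[1,2] + b@[1,3] + b@[1,4]
               - b@[2,2] - b@[2,3] - b@[2,4]) *
    (b@[3,6] = b@[1,1] + b@[1,2] + b@[1,3] - b@[2,2] - b@[2,3] - b@[2,4]) *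
    (b@[4,7] = b@[1,1] + b@[1,2] - b@[2,2] - b@[2,3]) *
    (b@[5,8] = b@[1,1] - b@[2,2])) *
   ((b@[3,5] = b@[2,2] + b@[2,3] + b@[2,4] - b@[3,3] - b@[3,4]) *
    (b@[4,6] = b@[2,2] + b@[2,3] - b@[3,3] - b@[3,4]) *
    (b@[5,7] = b@[2,2] - b@[3,3])) *
   ((b@[4,5] = b@[3,3] + b@[3,4] - b@[4,4]) *
    (b@[5,6] = b@[3,3] - b@[4,4]) *
    (b@[5,5] = b@[4,4])))%type.
Proof.
rewrite /row_sums /balanced unlock /=.
rewrite !addSn !add0n !addr0 !andbT.
case/and3P => /and5P[/eqP ? /eqP ? /eqP ? /eqP ? /eqP ?].
case/and4P=> /eqP ? /eqP ? /eqP ? /eqP ?.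
case/and3P=> /and3P[/eqP ? /eqP ? /eqP ?] /andP[/eqP ? /eqP ?] /eqP ?.
by repeat split; lia.
Qed.

Lemma entryD (b c : tableau) (i j : nat) : (b + c)@[i, j] = b@[i, j] + c@[i, j].
Proof. by rewrite /entry mxE. Qed.

Lemma entryN (b : tableau) (i j : nat) : (- b)@[i, j] = - b@[i, j].
Proof. by rewrite /entry mxE. Qed.

Lemma entry_apply_move (mv : move) (b : tableau) (i j : nat) :
  (0 < i < 6)%N && (i <= j < i + 5)%N ->
  (apply_move mv b)@[i, j] = b@[i, j] + move_entry mv i j.
Proof.
case/and3P=> /andP[i0 i6] ij ji; rewrite /entry mxE !inordK; try lia.
by rewrite prednK // subnKC // addrA.
Qed.

Lemma apply_move_inverse (mv : move) (b c : tableau) :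
  apply_move (inverse_move mv) b = c <-> apply_move mv c = b.
Proof.
by split=> <-; apply/matrixP => i j; rewrite !mxE /=; lia.
Qed.

(** * The operators are mutually inverse *)

(** The inverse move changes the difference of the two sides of each inequality selecting it by
    exactly one. This turns weak inequalities into strict ones and conversely, giving the condition
    under which [e_move] selects [mv]; the competing conditions then fail. *)
Lemma e_move_apply (k : idx) (b : tableau) (mv : move) :
  f_move k b = Some mv -> e_move k (apply_move (inverse_move mv) b) = Some mv.
Proof.
move=> fb; case eb: (e_move _ _) => [mv'|]; last by case: (e_move_total eb).
move: fb eb; rewrite /f_move; case: k => -[|[|[|[|[|[]]]]]] // k_lt /=.
all: rewrite /F1 /F2 /F3 /F4 /F5 /S_ /pos_part.
all: do ?case: ifP => ? //; case => <-.
all: rewrite /e_move /= /E1 /E2 /E3 /E4 /E5 /S_ /pos_part ?entry_apply_move //.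
all: rewrite /move_entry /=.
all: by do ?case: ifP => ? //; case => <- //; lia.
Qed.

Lemma f_move_apply (k : idx) (b : tableau) (mv : move) :
  e_move k b = Some mv -> f_move k (apply_move mv b) = Some mv.
Proof.
move=> eb; case fb: (f_move _ _) => [mv'|]; last by case: (f_move_total fb).
move: eb fb; rewrite /e_move; case: k => -[|[|[|[|[|[]]]]]] // k_lt /=.
all: rewrite /E1 /E2 /E3 /E4 /E5 /S_ /pos_part.
all: do ?case: ifP => ? //; case => <-.
all: rewrite /f_move /= /F1 /F2 /F3 /F4 /F5 /S_ /pos_part ?entry_apply_move //.
all: rewrite /move_entry /=.
all: by do ?case: ifP => ? //; case => <- //; lia.
Qed.

Lemma f_tab_e_tab (k : idx) (b c : tableau) :
  f_tab k b = Some c <-> e_tab k c = Some b.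
Proof.
rewrite /f_tab /e_tab; split.
- case fb: (f_move k b) => [mv|] //= [<-]; rewrite (e_move_apply fb) /=.
  by congr Some; apply/apply_move_inverse.
case ec: (e_move k c) => [mv|] //= [<-]; rewrite (f_move_apply ec) /=.
by congr Some; apply/apply_move_inverse.
Qed.

(** * Weights and the crystal axioms *)

(* [lia] is much slower on the entries than on variables. *)
Ltac generalize_entries b :=
  repeat match goal with
    | H : is_true _ |- _ => move: H
    | H : _ = false |- _ => move: H
    end;
  move: (b@[1,1]) (b@[1,2]) (b@[1,3]) (b@[1,4]) (b@[2,2]) (b@[2,3]) (b@[2,4])
        (b@[3,3]) (b@[3,4]) (b@[4,4]) => *.

(** Innermost maxima go first, so that no case hypothesis contains another maximum. *)
Ltac split_max := repeat match goal with |- context [Num.max ?x ?y] =>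
  lazymatch x with context [Num.max] => fail | _ => idtac end;
  lazymatch y with context [Num.max] => fail | _ => idtac end;
  case: (leP x y) => ? end.

Lemma max_of_ge (x : int) (s : seq int) :
  all (fun y => y <= max_of x s) (x :: s).
Proof.
apply/allP; elim: s => [|z s IHs] y /=; first by rewrite inE => /eqP ->.
rewrite !inE le_max orbCA => /orP[/eqP -> | ys]; first by rewrite lexx.
by rewrite IHs ?orbT // inE.
Qed.

(** After elimination, the terms in the maximum for [phi_tab] are those for [eps_tab], all shifted
    by one affine form; the maxima therefore cancel. *)
Lemma wt_tab_linear (l : int) (b : tableau) (k : idx) :
  row_sums l b && balanced b ->
  wt_tab l b k = nth 0
    [:: l - b@[1,1] - b@[1,2] - b@[2,2];
        b@[1,1] - b@[2,2] - b@[1,2];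
        b@[1,2] + b@[2,2] - b@[1,3] - b@[2,3] - b@[3,3];
        b@[1,3] - b@[1,4] + b@[2,3] - b@[2,4] + b@[3,3] - b@[3,4] - b@[4,4];
        b@[3,4] - l + b@[1,1] + b@[1,2] + b@[1,3] + 2 * b@[1,4] - b@[2,2]
          - b@[2,3] + b@[3,3] + b@[3,4];
        b@[4,4] - b@[1,1] - b@[1,2] - b@[1,3] + b@[2,2] + b@[2,3]
          + 2 * b@[2,4] - b@[3,3] + b@[4,4]] k.
Proof.
move=> hb; rewrite ffunE /phi_tab /eps_tab /max_of.
case: k => -[|[|[|[|[|[]]]]]] // k_lt /=;
  rewrite ?(lower_entries hb); clear hb; generalize_entries b; split_max; lia.
Qed.

Lemma wt_tab_apply_move (l : int) (b : tableau) (k : idx) (mv : move) :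
  row_sums l b && balanced b ->
  row_sums l (apply_move mv b) && balanced (apply_move mv b) ->
  e_move k b = Some mv ->
  wt_tab l (apply_move mv b) = wt_tab l b + simple_root k.
Proof.
move=> hb hmb; rewrite /e_move => eb; apply/ffunP => i.
rewrite [RHS]ffunE !wt_tab_linear // !entry_apply_move // ffunE.
case: k eb => -[|[|[|[|[|[]]]]]] // k_lt /=; do ?case: ifP => _ //; case=> <-;
  case: i => -[|[|[|[|[|[]]]]]] // i_lt;
  rewrite /cartan /move_entry /=; lia.
Qed.

Lemma eps_tab_apply_move (l : int) (b : tableau) (k : idx) (mv : move) :
  row_sums l b && balanced b ->
  row_sums l (apply_move mv b) && balanced (apply_move mv b) ->
  e_move k b = Some mv ->
  eps_tab l k (apply_move mv b) = eps_tab l k b - 1.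
Proof.
move=> hb hmb; rewrite /e_move /eps_tab /max_of /=.
case: k => -[|[|[|[|[|[]]]]]] // k_lt /=;
  rewrite ?(lower_entries hmb, lower_entries hb) !entry_apply_move //;
  clear hb hmb.
all: rewrite /E1 /E2 /E3 /E4 /E5 /S_ /pos_part.
(* For [k = 0] each condition suffices by itself, so the failures of the earlier ones are dropped.
   This goal splits into five, so [k = 1, ..., 5] become goals 6 to 10. *)
1: do ?case: ifP => [? | _] //; case=> <-.
6-10: do ?case: ifP => ? //; case=> <-.
all: by rewrite /move_entry /=; generalize_entries b; lia.
Qed.

Lemma tab_crystalP (P : pred tableau) (l : int) :
  (forall b, P b -> row_sums l b && balanced b) -> is_crystal (tab_crystal P l).
Proof.
move=> PE.
have efP (k : idx) (b b' : tab_crystal P l) :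
    (f k b = Some b' <-> f_tab k (val b) = Some (val b')) /\
    (e k b = Some b' <-> e_tab k (val b) = Some (val b')).
  have insubE (o : option tableau) :
      obind insub o = Some b' <-> o = Some (val b').
    case: o => [c|] //=; split=> [|[->]]; last by rewrite valK.
    by case: insubP => // u _ <- [->].
  by split; apply: insubE.
have eP (k : idx) (b b' : tab_crystal P l) : e k b = Some b' ->
    [/\ wt b' = wt b + simple_root k,
        eps k b' = omap (fun n => n - 1) (eps k b)
      & phi k b' = omap (fun n => n + 1) (phi k b)].
  move/(efP k b b').2; case: b b' => [b Pb] [b' Pb'] /=; rewrite /e_tab.
  case mvE: (e_move k b) => [mv|] //= [bE]; subst b'.
  have wtE := wt_tab_apply_move (PE _ Pb) (PE _ Pb') mvE.
  have epsE := eps_tab_apply_move (PE _ Pb) (PE _ Pb') mvE.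
  (* The rule for [phi] follows from those for [wt] and [eps], since the diagonal Cartan entry is
     2. *)
  split; rewrite ?wtE ?epsE //; congr Some; move/ffunP/(_ k): wtE.
  by rewrite !ffunE epsE /cartan eqxx; lia.
have fe (k : idx) (b b' : tab_crystal P l) :
    f k b = Some b' <-> e k b' = Some b.
  by rewrite (efP k b b').1 (efP k b' b).2 f_tab_e_tab.
split=> // [k b|k b b' /fe /eP[-> -> ->]].
  by rewrite /= ffunE addrC subrK.
by split; rewrite ?addrK //= ?subrK ?addrK.
Qed.

(** * Minimal elements *)

Local Arguments max_of : simpl never.

Lemma max_of_const (x : int) (s : seq int) :
  all (pred1 x) s -> max_of x s = x.
Proof.
rewrite /max_of; elim: s => //= y s IHs /andP[/eqP -> /IHs ->].
by rewrite maxxx.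
Qed.

Definition tight (b : tableau) : bool :=
  [&& b@[2,3] == b@[1,2], b@[2,4] == b@[1,3], b@[3,4] == b@[1,2],
      b@[3,3] == b@[1,3] + b@[4,4] & b@[2,2] == b@[1,4] + b@[1,3] + b@[4,4]].

Lemma eps_tab_tight (l : int) (b : tableau) (k : idx) :
  row_sums l b && balanced b -> tight b ->
  eps_tab l k b = nth 0
    [:: b@[4,4]; b@[1,2]; b@[1,3]; b@[1,4];
        l - b@[1,1] - b@[1,2] - b@[1,3] - b@[1,4];
        b@[1,1] - b@[1,3] - b@[1,4] - b@[4,4]] k.
Proof.
move=> hb /and5P[/eqP h1 /eqP h2 /eqP h3 /eqP h4 /eqP h5].
rewrite /eps_tab; case: k => -[|[|[|[|[|[]]]]]] // k_lt /=;
  rewrite ?(lower_entries hb) ?h1 ?h2 ?h3 ?h4 ?h5 ?max_of_const //;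
  try (rewrite /= !andbT); clear; generalize_entries b; lia.
Qed.

Lemma max_ofD (x d : int) (s : seq int) :
  max_of x s + d = max_of (x + d) [seq y + d | y <- s].
Proof. by rewrite /max_of; elim: s => //= y s <-; rewrite addr_maxl. Qed.

Lemma minimal_tight (l : int) (b : tableau) :
  row_sums l b && balanced b ->
  central_pairing [ffun k => eps_tab l k b] = l <-> tight b.
Proof.
move=> hb; rewrite /central_pairing !big_ord_recl big_ord0 !ffunE.
split; last by move=> tb; rewrite !(eps_tab_tight _ hb tb) /=; lia.
rewrite /tight /eps_tab /= !(lower_entries hb).
(* Each maximum becomes a variable known only to be at least each of its terms, which already forces
   the five equations. *)
do 5![match goal with |- context [max_of ?x ?s] =>
  have := max_of_ge x s; move: (max_of x s) => ? end].
clear hb; rewrite /=; generalize_entries b.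
by apply/and5P; split; apply/eqP; lia.
Qed.

(** * Translation by a minimal element *)

(** Terms are affine in the entries, and at the tight [c] all terms of one maximum take the same
    value, which comes out of the maximum as a constant. *)
Lemma eps_tabB (l : int) (b c : tableau) (k : idx) :
  row_sums l b && balanced b -> row_sums l c && balanced c ->
  row_sums 0 (b - c) && balanced (b - c) -> tight c ->
  eps_tab 0 k (b - c) = eps_tab l k b - eps_tab l k c.
Proof.
move=> hb hc hbc tc; rewrite (eps_tab_tight k hc tc).
case/and5P: tc => /eqP h1 /eqP h2 /eqP h3 /eqP h4 /eqP h5.
rewrite /eps_tab ?add0r; case: k => -[|[|[|[|[|[]]]]]] // k_lt /=;
  rewrite ?[l + max_of _ _]addrC -?[max_of _ _ + l - _]addrA ?max_ofD;
  rewrite ?add0r ?(lower_entries hb, lower_entries hbc) !(entryD, entryN);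
  rewrite ?h1 ?h2 ?h3 ?h4 ?h5.
all: try by [].
all: congr (max_of _ _); do ?congr (_ :: _).
all: clear.
all: by generalize_entries b; generalize_entries c; lia.
Qed.

(** The two sides of every condition change by the same amount, and the arguments of both positive
    parts vanish at [c]. The case of [e] will follow through [f_tab_e_tab]. *)
Lemma f_moveB (b c : tableau) (k : idx) :
  tight c -> f_move k (b - c) = f_move k b.
Proof.
case/and5P => /eqP h1 /eqP h2 /eqP h3 /eqP h4 /eqP h5.
have Fs : ((F1 (b - c) = F1 b) * (F2 (b - c) = F2 b) * (F3 (b - c) = F3 b) *
           (F4 (b - c) = F4 b) * (F5 (b - c) = F5 b))%type.
  have SE : S_ (b - c) = S_ b.
    by rewrite /S_ !entryD !entryN h1 h3 h4 h5; generalize_entries b; lia.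
  have dE : (b - c)@[1,3] - (b - c)@[2,4] = b@[1,3] - b@[2,4].
    by rewrite !entryD !entryN h2; generalize_entries b; lia.
  rewrite /F1 /F2 /F3 /F4 /F5 SE dE !entryD !entryN h1 h2 h3 h4 h5; clear.
  move: (pos_part (S_ b)) (pos_part (b@[1,3] - b@[2,4])) => p q.
  generalize_entries b; generalize_entries c.
  repeat split; lia.
rewrite /f_move !Fs !entryD !entryN h1 h2 h3 h4 h5; clear.
generalize_entries b; generalize_entries c.
case: k => -[|[|[|[|[|[]]]]]] // k_lt /=.
all: do ?case: ifP => ?; by [] || lia.
Qed.

Lemma f_tabB (b c : tableau) (k : idx) :
  tight c -> f_tab k (b - c) = omap (fun d => d - c) (f_tab k b).
Proof.
move=> tc; rewrite /f_tab f_moveB //; case: f_move => //= mv; congr Some.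
apply/matrixP => i j; rewrite !mxE -!addrA; congr (_ + _).
by rewrite addrC addrA.
Qed.

Lemma row_sums_balancedB (l m : int) (b c : tableau) :
  row_sums l b && balanced b -> row_sums m c && balanced c ->
  row_sums (l - m) (b - c) && balanced (b - c).
Proof.
have sumB (i p q : nat) : \sum_(p <= j < q) (b - c)@[i, j] =
    \sum_(p <= j < q) b@[i, j] - \sum_(p <= j < q) c@[i, j].
  by rewrite -sumrB; apply: eq_bigr => j _; rewrite entryD entryN.
move=> /andP[/allP rb /allP bb] /andP[/allP rc /allP bc].
apply/andP; split; apply/allP => i iP.
  by rewrite sumB (eqP (rb i iP)) (eqP (rc i iP)).
apply/allP => t tP; apply/implyP => it; rewrite !sumB.
have /allP/(_ t tP)/implyP/(_ it)/eqP -> := bb i iP.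
by have /allP/(_ t tP)/implyP/(_ it)/eqP -> := bc i iP.
Qed.

(** * Minimal elements with large entries *)

(** Solution of [tight] and [eps_k = 1] for all [k]: these fix the ten independent entries and the
    level 8, hence the rest. *)
Definition uniform_rows : seq (seq int) :=
  [:: [:: 4; 1; 1; 1; 1];
      [:: 3; 1; 1; 2; 1];
      [:: 2; 1; 2; 1; 2];
      [:: 1; 2; 1; 1; 3];
      [:: 1; 1; 1; 1; 4]].

(* For K > 0 this is the minimal element with eps_k = phi_k = K for all k; its
   level is 8 K. *)
Definition uniform_tableau (K : int) : tableau :=
  \matrix_(i, c) (K * nth 0 (nth [::] uniform_rows i) c).

Lemma entry_uniform_tableau (K : int) (i j : nat) :
  (0 < i < 6)%N && (i <= j < i + 5)%N ->
  (uniform_tableau K)@[i, j] = K * nth 0 (nth [::] uniform_rows i.-1) (j - i).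
Proof.
case/and3P=> /andP[i0 i6] ij ji; rewrite /entry mxE !inordK //; lia.
Qed.

Lemma uniform_tableau_relations (K : int) :
  [&& row_sums (8 * K) (uniform_tableau K), balanced (uniform_tableau K)
    & tight (uniform_tableau K)].
Proof.
rewrite /row_sums /balanced /tight unlock /= !entry_uniform_tableau //=; lia.
Qed.

(* An interlacing inequality that is not an equality compares sums of at most
   three entries, so 6 n bounds the contribution of x to its margin. *)
Lemma in_B5_uniform_shift (x : tableau) (n : nat) :
  in_B5inf x -> (forall i c, `|x i c| <= n%:Z) ->
  in_B5 (8 * (6 * n + 1)) (x + uniform_tableau (6 * n + 1)%N).
Proof.
move=> xinf xn; set d := uniform_tableau _.
have /and3P[rd bd _] := uniform_tableau_relations (6 * n + 1)%N.
have hx : row_sums (8 * (6 * n + 1))%N%:Z (x + d) && balanced (x + d).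
  (* Closure is available for differences, so [x + d] is treated as [x - (0 - d)]. *)
  have hNd : row_sums 0 (0 : tableau) && balanced 0 := in_B5inf0.
  have hd := introT andP (conj rd bd).
  have := row_sums_balancedB xinf (row_sums_balancedB hNd hd).
  by rewrite !sub0r !opprK -PoszM.
have [rx bx] := andP hx; rewrite /in_B5 rx bx /=; apply/andP; split.
  apply/forallP => i; apply/forallP => c; rewrite !mxE.
  have := xn i c; case: i => -[|[|[|[|[|[]]]]]] // i_lt;
    case: c => -[|[|[|[|[|[]]]]]] // c_lt; rewrite /=; lia.
have xe i j : `|x@[i, j]| <= n%:Z by apply: xn.
rewrite /interlaced unlock /= !(lower_entries hx) !entryD /d.
rewrite !entry_uniform_tableau //=.
move: (xe 1 1)%N (xe 1 2)%N (xe 1 3)%N (xe 1 4)%N (xe 2 2)%N (xe 2 3)%N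
      (xe 2 4)%N (xe 3 3)%N (xe 3 4)%N (xe 4 4)%N.
clear; generalize_entries x; lia.
Qed.

(** * The embeddings *)

Lemma in_B5_relations (l : nat) (b : tableau) :
  in_B5 l b -> row_sums l%:Z b && balanced b.
Proof. by case/and4P => _ -> ->. Qed.

Lemma in_B5B (l : nat) (b c : B5 l) : in_B5inf (val b - val c).
Proof.
have hc := in_B5_relations (valP c).
by have := row_sums_balancedB (in_B5_relations (valP b)) hc; rewrite subrr.
Qed.

Definition translate (l : nat) (c : B5 l) (b : B5 l) : B5inf :=
  exist (fun x : tableau => in_B5inf x) _ (in_B5B b c).

Lemma minimal_in_tight (l : nat) (c : B5 l) :
  minimal_in c <-> (0 < l)%N /\ tight (val c).
Proof. by rewrite -(minimal_tight (in_B5_relations (valP c))). Qed.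

Lemma wt_tabB (l : int) (b c : tableau) :
  row_sums l b && balanced b -> row_sums l c && balanced c ->
  wt_tab 0 (b - c) = wt_tab l b - wt_tab l c.
Proof.
move=> hb hc; apply/ffunP => k.
have := row_sums_balancedB hb hc; rewrite subrr => hbc.
rewrite [RHS]ffunE [(- wt_tab l c) k]ffunE !wt_tab_linear //.
rewrite !(entryD, entryN); clear.
generalize_entries b; generalize_entries c.
by case: k => -[|[|[|[|[|[]]]]]] // k_lt /=; lia.
Qed.

Lemma translate_embedding (l : nat) (c : B5 l) : minimal_in c ->
  @is_embedding (TBT (eps_wt c) (B5 l) (- phi_wt c)) B5inf
    (omap (fun x : TBT (eps_wt c) (B5 l) (- phi_wt c) => translate c x.1.2)).
Proof.
move=> /minimal_in_tight[_ tc].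
have hc := in_B5_relations (valP c).
have epsE k (b : B5 l) :
    eps_tab 0 k (val b - val c) = eps_tab l k (val b) - eps_wt c k.
  rewrite ffunE.
  exact: eps_tabB (in_B5_relations (valP b)) hc (in_B5B b c) tc.
have wtE (b : B5 l) :
    wt_tab 0 (val b - val c) = eps_wt c - phi_wt c + wt_tab l (val b).
  rewrite (wt_tabB (in_B5_relations (valP b)) hc) addrC; congr (_ + _).
  by apply/ffunP => k; rewrite !ffunE opprB.
split=> //.
- case=> [[[[] b] []]|] [[[[] b'] []]|] //= [] /addIr /val_inj -> //.
- by case=> [[[] b] []] _ [<-]; apply: wtE.
- by move=> k [[[] b] []] _ [<-] /=; rewrite epsE.
(* Preservation of [phi] follows from that of [wt] and [eps]. *)
- move=> k [[[] b] []] _ [<-] /=; congr Some.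
  move/ffunP/(_ k): (wtE b); rewrite !ffunE epsE ffunE /=; lia.
move=> k [[[] b] []] [[[] b'] []] /=.
case fb: (obind _ _) => [b''|] //= [bE]; subst b''.
have {}fb : f_tab k (val b - val c) = Some (val b' - val c).
  by rewrite f_tabB //; case: f_tab fb => //= d; case: insubP => // u _ <- [->].
have eb : e_tab k (val b' - val c) = Some (val b - val c) by apply/f_tab_e_tab.
rewrite fb eb /= !insubT ?in_B5B // => ? ?.
by split; congr Some; apply: val_inj.
Qed.

(** * The limit *)

Theorem theorem3p1 : coherent B5 /\ is_limit B5 b5inf.
Proof.
suff lim : is_limit B5 b5inf by split=> //; exists B5inf, b5inf.
have t0 : tight 0 by rewrite /tight /entry !mxE.
(* The values at the zero tableau come from writing it as [0 - 0], with [0] itself tight. *)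
have wt0 : wt_tab 0 0 = 0.
  by have := wt_tabB in_B5inf0 in_B5inf0; rewrite !subrr.
have eps0 k : eps_tab 0 k 0 = 0.
  have := @eps_tabB 0 0 0 k in_B5inf0 in_B5inf0.
  by rewrite !subrr => /(_ in_B5inf0 t0).
split=> //.
- by move=> l l0; split=> //; apply/tab_crystalP/in_B5_relations.
- exact: tab_crystalP.
- move=> k; rewrite /= eps0; split=> //; congr Some.
  by move/ffunP/(_ k): wt0; rewrite !ffunE eps0 subr0.
exists (fun l c => omap (fun x => translate c x.1.2)); split.
  move=> l c cmin; split; first exact: translate_embedding.
  by congr Some; apply: val_inj; rewrite /= subrr.
case=> x xinf.
pose n := (\sum_i \sum_j `|x i j|)%N; pose l := (8 * (6 * n + 1))%N.
have xn i j : `|x i j| <= n%:Z.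
  by rewrite -abszE lez_nat /n (bigD1 i) //= (bigD1 j) //= -addnA leq_addr.
(* This is the case of the zero tableau in the shift lemma. *)
have c_in : in_B5 l (uniform_tableau (6 * n + 1)%N).
  by rewrite -[uniform_tableau _]add0r in_B5_uniform_shift ?in_B5inf0 // => i j;
    rewrite mxE normr0.
pose c : B5 l := exist (fun b : tableau => in_B5 l b) _ c_in.
(* [y] is [x + c], so translation by [c] sends it to [x]. *)
pose y : B5 l :=
  exist (fun b : tableau => in_B5 l b) _ (in_B5_uniform_shift xinf xn).
exists l, c; split.
  apply/minimal_in_tight; split; first by rewrite /l; lia.
  by case/and3P: (uniform_tableau_relations (6 * n + 1)%N).
exists (tbt _ y _).
by congr Some; apply: val_inj; rewrite /= addrK.
Qed.
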